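(* Let $\mathbb{F}$ be a skew field, $\Phi=(N,E,\varphi)$ a gain graph with gains in $\mathbb{F}^\times$ having no two links with the same endpoints and equal gain and at most one half edge per node, and consider $\mathbb{P}_N(\mathbb{F})$ with coordinate points $\hat v$ ($v\in N$) and $h_\infty:\sum_v x_v=0$. For a half edge at $v$ put $\mathbf{e}=\hat v$; for a link $e=e_{vw}$ put $\mathbf{e}$ = the point spanned by $(1+\varphi(e_{vw}))^{-1}(\varphi(e_{vw})\hat v+\hat w)$ if $\varphi(e_{vw})\neq-1$, and $\mathbf{e}=h_\infty\cap\hat v\hat w$ if $\varphi(e_{vw})=-1$. Let $\mathbf{h}(e)=h(\mathbf{e})$ be the apical hyperplane with apex $\mathbf{e}$ and $\mathcal{C}[\Phi]=\{\mathbf{h}(e):e\in E\}$. Then $v\mapsto\hat v^*$, $e\mapsto\mathbf{h}(e)$ give isomorphisms $\langle\Phi\rangle\cong\Omega(\mathcal{C}[\Phi])$ and $G(\Phi)\cong M(\mathcal{C}[\Phi])$. Conversely, if $\Omega$ is a biased graph and $\mathcal{A}$ is a set of apical hyperplanes of the coordinate basis $\hat N$ of $\mathbb{P}_N(\mathbb{F})$ with $\Omega\cong\Omega(\mathcal{A})$ (i.e., a synthetic Cevian representation of the frame matroid of $\Omega$), then there are gains $\varphi$ in $\mathbb{F}^\times$ on the links of $\Omega$ such that $\Phi=(\|\Omega\|,\varphi)$ satisfies $\langle\Phi\rangle=\Omega$ and $\mathcal{A}=\mathcal{C}[\Phi]$.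
   Context: $\mathbb{P}_N(\mathbb{F})$: projective space of 1-dimensional subspaces of the left $\mathbb{F}$-vector space with basis indexed by $N$; $\hat v$ the point of the $v$-th unit vector. Gains satisfy $\varphi(e_{wv})=\varphi(e_{vw})^{-1}$; $\langle\Phi\rangle$ has as balanced circles those with gain product $1$. Apical hyperplane with apex $p\in\hat v\hat w$: $h(p)=\mathrm{Span}((\hat N\setminus\{\hat v,\hat w\})\cup\{p\})$ if $p\notin\hat N$, and $h(\hat v)=\hat v^*=\mathrm{Span}(\hat N\setminus\{\hat v\})$. For a set $\mathcal{A}$ of apical hyperplanes, $\Omega(\mathcal{A})$ has node set $N$, a half edge at $v$ for $\hat v^*$, a link $e_{vw}$ for each $h(p)$ with $p\in\hat v\hat w\setminus\hat N$, and a circle $C$ is balanced iff $\operatorname{codim}\bigcap_{e\in C}\mathbf{h}(e)<\#C$. $M(\mathcal{A})$ is the matroid on $\mathcal{A}$ with rank $\mathcal{S}\mapsto\operatorname{codim}\bigcap\mathcal{S}$. The frame matroid $G(\Omega)$ has rank $\#N(S)-b(S)$ on finite $S$, $b(S)$ the number of balanced components (no half edges, all circles balanced) of $(N(S),S)$; $G(\Phi)=G(\langle\Phi\rangle)$.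
   Formalization: In the converse the isomorphism Ω≅Ω(A) is taken to be the identity on the node set N (v↦v̂* ), as A=C[Φ] fails for one that permutes nodes; the gain product of a circle with edges e_1,…,e_k is φ(e_k)…φ(e_1), the order needed when F is noncommutative. *)

(* Defs.v *)
From HB Require Import structures.
From mathcomp Require Import all_boot all_algebra.
From mathcomp Require Import finmap all_classical.
From mathcomp.multinomials Require Import monalg.

Set Implicit Arguments.
Unset Strict Implicit.
Unset Printing Implicit Defensive.

Import GRing.Theory.

Local Open Scope classical_set_scope.
Local Open Scope ring_scope.

(* Every set counted below is finite; [ncard] is 0 on infinite sets. *)
Definition ncard (T : choiceType) (A : set T) : nat := #|` fset_set A|.

(* Possibly infinite.  The nodes are all of N; the edges form a set in an
   ambient type E, so that a set of hyperplanes can serve as edge set. *)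
Record graph (N E : choiceType) := Graph {
  edges   : set E;
  half_at : E -> N -> Prop;
  joins   : E -> N -> N -> Prop
}.

Section Graph.
Variables (N E : choiceType).
Implicit Types (G : graph N E) (e : E) (u v w x y : N) (p : seq (E * N)).

Definition is_half_edge G e : Prop :=
  (exists v, forall x, half_at G e x <-> x = v) /\
  (forall x y, ~ joins G e x y).

Definition is_link G e : Prop :=
  (exists v w, v <> w /\
     forall x y, joins G e x y <-> (x = v /\ y = w) \/ (x = w /\ y = v)) /\
  (forall x, ~ half_at G e x).

Definition is_graph G : Prop :=
  forall e, edges G e -> is_half_edge G e \/ is_link G e.

Definition incident G e v : Prop := half_at G e v \/ exists w, joins G e v w.

(* The walk that starts at v and successively crosses an edge e to reach a
   node w, for (e, w) running through p. *)
Fixpoint walk G v p : Prop :=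
  if p is (e, w) :: p' then
    [/\ edges G e, joins G e v w & walk G w p']
  else True.

Definition walk_end v p : N := last v (unzip2 p).

Definition edge_set p : {fset E} := [fset e in unzip1 p]%fset.

Definition circle_walk G v p : Prop :=
  [/\ walk G v p, walk_end v p = v, p != [::],
      uniq (unzip2 p) & uniq (unzip1 p)].

Definition circle G (C : {fset E}) : Prop :=
  exists v p, circle_walk G v p /\ C = edge_set p.

Definition simple_path G u w p : Prop :=
  [/\ walk G u p, walk_end u p = w & uniq (u :: unzip2 p)].

Definition internally_disjoint w p q : Prop :=
  (forall x, x \in unzip2 p -> x \in unzip2 q -> x = w) /\
  (forall e, e \in unzip1 p -> e \notin unzip1 q).

Definition theta G p q r : Prop :=
  exists u w, [/\ u <> w,
    [/\ simple_path G u w p, simple_path G u w q & simple_path G u w r] &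
    [/\ internally_disjoint w p q, internally_disjoint w q r &
        internally_disjoint w p r]].

Definition node_set G (S : {fset E}) : set N :=
  [set v | exists2 e, e \in S & incident G e v].

Definition connected_by G (S : {fset E}) x y : Prop :=
  exists p, [/\ walk G x p, walk_end x p = y & {subset unzip1 p <= S}].

Definition components G (S : {fset E}) : set (set N) :=
  [set X | exists2 x, node_set G S x & X = [set y | connected_by G S x y]].

Definition edges_in G (S : {fset E}) (X : set N) : {fset E} :=
  [fset e in S | `[< exists2 v, X v & incident G e v >]]%fset.

End Graph.

Record biased_graph (N E : choiceType) := BiasedGraph {
  bg_graph : graph N E;
  balanced : set {fset E}
}.

(* [theta] is invariant under permutation of the three paths, so the last
   condition says that no theta subgraph has exactly two balanced circles. *)
Definition is_biased_graph (N E : choiceType) (O : biased_graph N E) : Prop :=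
  [/\ is_graph (bg_graph O),
      balanced O `<=` circle (bg_graph O) &
      forall p q r, theta (bg_graph O) p q r ->
        balanced O (edge_set p `|` edge_set q)%fset ->
        balanced O (edge_set q `|` edge_set r)%fset ->
        balanced O (edge_set p `|` edge_set r)%fset].

Definition is_biased_iso (N N' E E' : choiceType)
    (O : biased_graph N E) (O' : biased_graph N' E')
    (g : N -> N') (f : E -> E') : Prop :=
  let G := bg_graph O in let G' := bg_graph O' in
  [/\ bijective g,
      set_bij (edges G) (edges G') f,
      forall e v, edges G e -> half_at G e v <-> half_at G' (f e) (g v),
      forall e v w, edges G e ->
        joins G e v w <-> joins G' (f e) (g v) (g w) &
      forall C : {fset E}, [set` C] `<=` edges G ->
        balanced O C <-> balanced O' [fset f e | e in C]%fset].

(* A finitary matroid is given by its rank function on the finite subsets of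
   its ground set. *)
Record matroid (E : choiceType) := Matroid {
  ground : set E;
  mrank  : {fset E} -> nat
}.

Definition is_matroid_iso (E E' : choiceType)
    (M : matroid E) (M' : matroid E') (f : E -> E') : Prop :=
  set_bij (ground M) (ground M') f /\
  forall S : {fset E}, [set` S] `<=` ground M ->
    mrank M' [fset f e | e in S]%fset = mrank M S.

Section Frame.
Variables (N E : choiceType) (O : biased_graph N E).
Let G := bg_graph O.

Definition balanced_edge_set (S : {fset E}) : Prop :=
  (forall e v, e \in S -> ~ half_at G e v) /\
  (forall C : {fset E}, (C `<=` S)%fset -> circle G C -> balanced O C).

Definition balanced_components (S : {fset E}) : set (set N) :=
  [set X | components G S X /\ balanced_edge_set (edges_in G S X)].

Definition frame_matroid : matroid E :=
  Matroid (edges G)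
    (fun S => (ncard (node_set G S) - ncard (balanced_components S))%N).

End Frame.

(* [gain P e v w] is phi(e_vw); it is irrelevant unless e joins v and w. *)
Record gain_graph (F : unitRingType) (N E : choiceType) := GainGraph {
  gg_graph : graph N E;
  gain     : E -> N -> N -> F
}.

Section Gain.
Variables (F : unitRingType) (N E : choiceType).
Implicit Types (P : gain_graph F N E).

Definition is_gain_graph P : Prop :=
  is_graph (gg_graph P) /\
  forall e v w, edges (gg_graph P) e -> joins (gg_graph P) e v w ->
    gain P e v w != 0 /\ gain P e w v = (gain P e v w)^-1.

Definition gain_simple P : Prop :=
  let G := gg_graph P in
  (forall e e' v w, edges G e -> edges G e' ->
     joins G e v w -> joins G e' v w -> gain P e v w = gain P e' v w ->
     e = e') /\
  (forall e e' v, edges G e -> edges G e' ->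
     half_at G e v -> half_at G e' v -> e = e').

(* The gain of a walk v0 e1 v1 ... ek vk is the product, in order of
   composition, phi(ek) * ... * phi(e1).  In a left vector space the
   hyperplane of the link e_vw has equation x_v = x_w phi(e_vw), so along a
   circle x_v0 = x_vk phi(ek) ... phi(e1): over a noncommutative F the order
   of the factors matters, and this is the one in which the balanced circles
   of the gain graph are those of its hyperplanes. *)
Fixpoint walk_gain P (v : N) (p : seq (E * N)) : F :=
  if p is (e, w) :: p' then walk_gain P w p' * gain P e v w else 1.

(* Whether the gain of a circle is 1 depends neither on the starting node nor
   on the direction of the traversal. *)
Definition bias_of P : biased_graph N E :=
  BiasedGraph (gg_graph P)
    [set C | exists v p, [/\ circle_walk (gg_graph P) v p,
                             C = edge_set p & walk_gain P v p = 1]].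

End Gain.

(* The left F-vector space with basis indexed by N is {malg F[N]}, the
   finitely supported functions N -> F.  Flats of the projective space are
   linear subspaces; in particular points are subspaces of dimension 1, and
   the projective codimension of a flat is its linear codimension. *)
Section Projective.
Variables (F : unitRingType) (N : choiceType).
Local Notation V := {malg F[N]}.

Definition is_subspace (W : set V) : Prop :=
  W 0 /\ forall (a : F) x y, W x -> W y -> W (a *: x + y).

Definition point_of (x : V) : set V := [set y | exists a : F, y = a *: x].

Definition is_point (p : set V) : Prop := exists2 x, x != 0 & p = point_of x.

Definition Span (Q : set (set V)) : set V :=
  smallest is_subspace (\bigcup_(q in Q) q).

Definition unit_vec (v : N) : V := << v >>.

Definition hat (v : N) : set V := point_of (unit_vec v).

Definition hatN : set (set V) := range hat.

Definition line (v w : N) : set V := Span [set hat v; hat w].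

Definition h_inf : set V := [set x : V | \sum_(v <- msupp x) x@_v = 0].

Definition coord_hyp (v : N) : set V := Span (hatN `\ hat v).

Definition link_apex (v w : N) (p : set V) : Prop :=
  [/\ v <> w, is_point p, p `<=` line v w & ~ hatN p].

(* H is the apical hyperplane with apex p. *)
Definition apex_of (p H : set V) : Prop :=
  (exists2 v, p = hat v & H = coord_hyp v) \/
  (exists v w, link_apex v w p /\
     H = Span ((hatN `\` [set hat v; hat w]) `|` [set p])).

Definition apical (p : set V) : set V := xget set0 [set H | apex_of p H].

Definition apical_hyperplane (H : set V) : Prop := exists p, apex_of p H.

(* n is the dimension of the quotient V / W. *)
Definition has_codim (W : set V) (n : nat) : Prop :=
  exists b : 'I_n -> V, forall x : V,
    exists! a : {ffun 'I_n -> F}, W (x - \sum_i a i *: b i).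

(* Only used for finite intersections of hyperplanes; 0 in infinite
   codimension. *)
Definition codim (W : set V) : nat := xget 0%N [set n | has_codim W n].

Definition apical_graph (A : set (set V)) : graph N (set V) :=
  Graph A
    (fun H v => H = coord_hyp v)
    (fun H v w => exists2 p, link_apex v w p & H = apical p).

Definition apical_biased (A : set (set V)) : biased_graph N (set V) :=
  BiasedGraph (apical_graph A)
    [set C | circle (apical_graph A) C /\
             (codim (\bigcap_(H in [set` C]) H) < #|` C|)%N].

Definition hyp_matroid (A : set (set V)) : matroid (set V) :=
  Matroid A (fun S => codim (\bigcap_(H in [set` S]) H)).

Variable E : choiceType.
Implicit Types (P : gain_graph F N E).

Definition link_point (v w : N) (a : F) : set V :=
  if a == -1 then h_inf `&` line v w
  else point_of ((1 + a)^-1 *: (a *: unit_vec v + unit_vec w)).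

Definition edge_point_spec P (e : E) (p : set V) : Prop :=
  (exists2 v, half_at (gg_graph P) e v & p = hat v) \/
  (exists v w, joins (gg_graph P) e v w /\ p = link_point v w (gain P e v w)).

(* The specification determines p: for a link, both orientations yield the
   same point. *)
Definition edge_point P (e : E) : set V := xget set0 [set p | edge_point_spec P e p].

Definition edge_hyp P (e : E) : set V := apical (edge_point P e).

Definition cevian P : set (set V) := edge_hyp P @` edges (gg_graph P).

End Projective.

(* Main.v *)
Require Import Defs.
From mathcomp Require Import all_boot all_algebra.
From mathcomp Require Import finmap all_classical.
From mathcomp.multinomials Require Import monalg.
From mathcomp Require Import zify.

Set Implicit Arguments.
Unset Strict Implicit.
Unset Printing Implicit Defensive.

Import GRing.Theory.

(** The apical hyperplane of a half edge at [v] is [x_v = 0], and that of a link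
    with gain [a] from [v] to [w] is [x_v = x_w a].  On the hyperplanes of a set
    [S] of edges the coordinates therefore form a potential along [S].  A
    balanced component of [S] leaves exactly one free coordinate (the others are
    nonzero right multiples of it, independently of the walk chosen), whereas a
    half edge or a circle of gain other than [1] kills every coordinate of its
    component.  Hence the intersection is the graph of a map on coordinates and
    has codimension [#N(S) - b(S)]; for a circle this gives the bias.
    Conversely, an apical hyperplane with apex on [vw] determines its gain.
    Codimension is well defined because finite bases over a skew field have
    equal cardinality. *)

(** * Linear algebra over a skew field *)

Section SkewField.
Local Open Scope ring_scope.

Variables (F : unitRingType) (hF : GRing.field_axiom F).

Lemma skew_unit (a : F) : a != 0 -> a \is a GRing.unit.
Proof. by move=> a0; apply: hF. Qed.

Lemma skew_inv_neq0 (a : F) : a != 0 -> a^-1 != 0.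
Proof.
by move=> a0; apply: contraTneq (skew_unit a0) => a'0; rewrite -unitrV a'0 unitr0.
Qed.

Lemma skew_mul_neq0 (a b : F) : a != 0 -> b != 0 -> a * b != 0.
Proof.
move=> a0 b0; apply: contraNneq a0 => ab0.
by rewrite -[a](mulrK (skew_unit b0)) ab0 mul0r.
Qed.

Lemma skew_mul_eq0 (a b : F) : b != 0 -> a * b = 0 -> a = 0.
Proof.
move=> b0 ab0; apply/eqP; case: (eqVneq a 0) => // a0.
by move: (skew_mul_neq0 a0 b0); rewrite ab0 eqxx.
Qed.

Lemma left_dependence n m (A : 'I_m -> 'I_n -> F) : (n < m)%N ->
  exists c : 'I_m -> F,
    (exists i, c i != 0) /\ forall j, \sum_i c i * A i j = 0.
Proof.
elim: n m A => [|n IHn] m A.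
  case: m A => // m A _; exists (fun=> 1); split; last by case.
  by exists ord0; rewrite oner_neq0.
case: m A => // m A lt_nm.
have [/existsP[i0 Ai0] | /existsPn A0] := boolP [exists i, A i ord0 != 0].
  (* Row [lift i0 k] minus the left multiple of the pivot row [i0] that clears column 0; [c0] below
     collects the pivot multiples that are used. *)
  pose A' k j := A (lift i0 k) (lift ord0 j)
                 - A (lift i0 k) ord0 * (A i0 ord0)^-1 * A i0 (lift ord0 j).
  have [c' [[k0 ck0] c'A]] := IHn m A' lt_nm.
  pose c0 := - \sum_k c' k * (A (lift i0 k) ord0 * (A i0 ord0)^-1).
  pose c i := if unlift i0 i is Some k then c' k else c0.
  have cl k : c (lift i0 k) = c' k by rewrite /c liftK.
  have ci0 : c i0 = c0 by rewrite /c unlift_none.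
  exists c; split; first by exists (lift i0 k0); rewrite cl.
  move=> j; rewrite (bigD1_ord i0) //= ci0.
  under eq_bigr do rewrite cl.
  case: (unliftP ord0 j) => [j' ->|->].
    rewrite -[RHS](c'A j') /c0 mulNr mulr_suml addrC -sumrB.
    by apply: eq_bigr => k _; rewrite /A' mulrBr !mulrA.
  rewrite /c0 mulNr mulr_suml addrC -sumrB big1 // => k _.
  by rewrite -!mulrA mulVr ?skew_unit // mulr1 subrr.
(* Column 0 vanishes, so a dependence of the other columns suffices. *)
have [c [nzc cA]] := IHn m.+1 (fun i j => A i (lift ord0 j)) (ltnW lt_nm).
exists c; split=> // j; case: (unliftP ord0 j) => [j' ->|->]; first exact: cA.
by rewrite big1 // => i _; move: (A0 i); rewrite negbK => /eqP->; rewrite mulr0.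
Qed.

End SkewField.

(** * Codimension and coordinate equations of subspaces *)

Section Hyperplanes.
Local Open Scope classical_set_scope.
Local Open Scope ring_scope.

Variables (F : unitRingType) (hF : GRing.field_axiom F) (N : choiceType).
Local Notation V := {malg F[N]}.
Local Notation hat := (@hat F N).
Local Notation hatN := (@hatN F N).
Local Notation line := (@line F N).
Implicit Types (x y : V) (u v w : N) (a : F) (W : set V).

Lemma subspace_sum W (I : Type) (r : seq I) (P : pred I) (f : I -> V) :
  is_subspace W -> (forall i, P i -> W (f i)) -> W (\sum_(i <- r | P i) f i).
Proof.
move=> [W0 WD] Wf; elim/big_rec: _ => // i x Pi Wx.
by rewrite -[f i]scale1r; apply: WD => //; apply: Wf.
Qed.

Lemma subspaceZ W a x : is_subspace W -> W x -> W (a *: x).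
Proof. by move=> [W0 WD] Wx; rewrite -[_ *: _]addr0; apply: WD. Qed.

Lemma subspaceD W x y : is_subspace W -> W x -> W y -> W (x + y).
Proof. by move=> [W0 WD] Wx Wy; rewrite -[x]scale1r; apply: WD. Qed.

Lemma mcoeff_sum v (I : Type) (r : seq I) (P : pred I) (f : I -> V) :
  (\sum_(i <- r | P i) f i)@_v = \sum_(i <- r | P i) (f i)@_v.
Proof. exact: raddf_sum. Qed.

Lemma mcoeff_unit_vec u v : (unit_vec F u)@_v = (u == v)%:R.
Proof. exact: mcoeffU. Qed.

(** If [m > n], the [m] basis vectors of [V / W], expanded in the [n] others, would satisfy a
    nontrivial left dependence modulo [W]. *)
Lemma has_codim_leq W n m : is_subspace W ->
  has_codim W n -> has_codim W m -> (m <= n)%N.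
Proof.
move=> subW [b hb] [c hc]; rewrite leqNgt; apply/negP => lt_nm.
have /choice[A hA] : forall i, exists a : {ffun 'I_n -> F},
    W (c i - \sum_j a j *: b j) by move=> i; have [a []] := hb (c i); exists a.
have [d [[i0 di0] dA]] := left_dependence hF (fun i j => A i j) lt_nm.
have Wd : W (\sum_i d i *: c i).
  have -> : \sum_i d i *: c i = \sum_i d i *: (c i - \sum_j A i j *: b j).
    under [RHS]eq_bigr do rewrite scalerBr scaler_sumr.
    rewrite sumrB exchange_big /= [X in _ - X]big1 ?subr0 // => j _.
    by under eq_bigr do rewrite scalerA; rewrite -scaler_suml dA scale0r.
  by apply: subspace_sum => // i _; apply: subspaceZ.
(* Modulo [W], the zero vector has two expansions in [c]: the trivial one and the one with
   coefficients [- d]. *)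
have [a [_ uniq_a]] := hc 0.
have a0 : a = [ffun=> 0].
  apply: uniq_a; rewrite big1 ?subr0; first by case: subW.
  by move=> i _; rewrite ffunE scale0r.
have ad : a = [ffun i => - d i].
  apply: uniq_a; rewrite sub0r -sumrN.
  by under eq_bigr do rewrite ffunE scaleNr opprK.
move: di0; rewrite -oppr_eq0 -[_ == _]/(_ == 0) => /eqP; apply.
by have := congr1 (fun f : {ffun _} => f i0) ad; rewrite a0 !ffunE.
Qed.

Lemma codim_eq W n : is_subspace W -> has_codim W n -> codim W = n.
Proof.
move=> subW Wn; apply: xget_unique => // m Wm; apply/eqP.
by rewrite eqn_leq !(has_codim_leq subW).
Qed.

(** A bound coordinate [y] in [B] is a right multiple of the coordinate at its root [r y]; the
    factor [t y = 0] encodes the equation [x_y = 0]. *)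
Definition graph_subspace (B : {fset N}) (r : N -> N) (t : N -> F) : set V :=
  [set x | forall y : N, y \in B -> x@_y = x@_(r y) * t y].

Lemma graph_subspace_subspace B r t : is_subspace (graph_subspace B r t).
Proof.
split=> [y _|a x y Wx Wy v Bv]; first by rewrite !mcoeff0 mul0r.
by rewrite !mcoeffD !mcoeffZ Wx // Wy // mulrDl mulrA.
Qed.

(** Under the hypothesis the bound coordinates depend on free ones only, so the unit vectors at [B]
    form a basis of the quotient. *)
Lemma codim_graph_subspace (B : {fset N}) r t :
  (forall y : N, y \in B -> r y \notin B \/ t y = 0) ->
  codim (graph_subspace B r t) = #|` B|.
Proof.
move=> hB; apply: codim_eq; first exact: graph_subspace_subspace.
(* An enumeration of [B]; the default of [nth] is drawn from [B] itself, as [N] has no distinguished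
   element. *)
pose nd (i : 'I_#|` B|) : N := nth (fsval (enum_val (cast_ord (cardfE B) i))) B i.
have ndB i : nd i \in B by apply: mem_nth.
have nd_inj : injective nd.
  move=> i j; rewrite /nd (set_nth_default (nd j)) // => /eqP.
  by rewrite /nd [X in _ == X](set_nth_default (nd j)) // nth_uniq // => /eqP/val_inj.
have ndP (y : N) : y \in B -> exists i, y = nd i.
  move=> By; have lt_i : (index y B < #|` B|)%N by rewrite index_mem.
  by exists (Ordinal lt_i); rewrite /nd nth_index.
exists (fun i => unit_vec F (nd i)) => x.
have coefB (a : {ffun 'I_#|` B| -> F}) i :
    (x - \sum_j a j *: unit_vec F (nd j))@_(nd i) = x@_(nd i) - a i.
  rewrite mcoeffB mcoeff_sum (bigD1 i) //= big1 => [|j ne_ji].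
    by rewrite addr0 mcoeffZ mcoeff_unit_vec eqxx mulr1.
  by rewrite mcoeffZ mcoeff_unit_vec (inj_eq nd_inj) (negPf ne_ji) mulr0.
have coefNB (a : {ffun 'I_#|` B| -> F}) (y : N) : y \notin B ->
    (x - \sum_j a j *: unit_vec F (nd j))@_y = x@_y.
  move=> nBy; rewrite mcoeffB mcoeff_sum big1 ?subr0 // => j _.
  rewrite mcoeffZ mcoeff_unit_vec; case: eqP => [jy|]; last by rewrite mulr0.
  by rewrite -jy ndB in nBy.
(* Subtracting unit vectors at [B] leaves the right-hand sides of the equations unchanged: the root
   is free or the factor is zero. This forces the coefficients given next. *)
have coef_root (a : {ffun 'I_#|` B| -> F}) i :
    (x - \sum_j a j *: unit_vec F (nd j))@_(r (nd i)) * t (nd i) =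
    x@_(r (nd i)) * t (nd i).
  by case: (hB _ (ndB i)) => [/coefNB->//|->]; rewrite !mulr0.
exists [ffun i => x@_(nd i) - x@_(r (nd i)) * t (nd i)]; split.
  by move=> _ /ndP[i ->]; rewrite coefB coef_root ffunE opprB addrC subrK.
move=> a Wa; apply/ffunP => i; rewrite ffunE -(coef_root a) -(Wa _ (ndB i)) coefB.
by rewrite opprB addrC subrK.
Qed.

(** * Spans, points and hyperplane equations *)

Lemma Span_subspace (Q : set (set V)) : is_subspace (Span Q).
Proof.
split=> [W [[W0 _] _]//|a x y Qx Qy W hW]; have [[_ WD] _] := hW.
by apply: WD; [apply: Qx|apply: Qy].
Qed.

Lemma point_of_self x : point_of x x.
Proof. by exists 1; rewrite scale1r. Qed.

Lemma mem_Span (Q : set (set V)) p x : Q p -> p x -> Span Q x.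
Proof. by move=> Qp px W [_ QW]; apply: QW; exists p. Qed.

Lemma point_ofZ a x : a != 0 -> point_of (a *: x) = point_of x.
Proof.
move=> a0; apply/seteqP; split=> _ [b ->]; first by exists (b * a); rewrite scalerA.
by exists (b * a^-1); rewrite scalerA divrK // skew_unit.
Qed.

Lemma hat_inj : injective hat.
Proof.
move=> u v euv; have [a] : hat v (unit_vec F u) by rewrite -euv; apply: point_of_self.
move=> /malgP/(_ u)/esym/eqP; rewrite mcoeffZ !mcoeff_unit_vec eqxx; case: (eqVneq v u) => // _.
by rewrite mulr0 eq_sym oner_eq0.
Qed.

Lemma unit_vec_sum x : x = \sum_(v <- msupp x) x@_v *: unit_vec F v.
Proof.
rewrite {1}(monalgE x); apply: eq_bigr => v _; apply/malgP => u.
by rewrite mcoeffZ mcoeff_unit_vec mcoeffU mulr_natr.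
Qed.

Definition zero_hyp v : set V := [set x | x@_v = 0].
Definition link_hyp v w a : set V := [set x | x@_v = x@_w * a].

Lemma zero_hyp_subspace v : is_subspace (zero_hyp v).
Proof.
split=> [|a x y]; first exact: mcoeff0.
by rewrite /zero_hyp /= mcoeffD mcoeffZ => -> ->; rewrite mulr0 addr0.
Qed.

Lemma link_hyp_subspace v w a : is_subspace (link_hyp v w a).
Proof.
split=> [|b x y]; first by rewrite /link_hyp /= !mcoeff0 mul0r.
by rewrite /link_hyp /= !mcoeffD !mcoeffZ => -> ->; rewrite mulrDl mulrA.
Qed.

Lemma coord_hypE v : coord_hyp v = zero_hyp v.
Proof.
apply/seteqP; split.
  apply: smallest_sub; first exact: zero_hyp_subspace.
  move=> x [_ [[u _ <-] ne_uv] [a ->]].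
  rewrite /zero_hyp /= mcoeffZ mcoeff_unit_vec; case: eqP => [uv|_]; last by rewrite mulr0.
  by case: ne_uv; rewrite uv.
move=> x xv; rewrite (unit_vec_sum x); apply: subspace_sum; first exact: Span_subspace.
move=> u _; have [->|/eqP ne_uv] := eqVneq u v.
  by rewrite xv scale0r; case: (Span_subspace (hatN `\ hat v)).
apply: (mem_Span (p := hat u)); last by exists x@_u.
by split; [exists u|move=> /hat_inj].
Qed.

(** A representative of the apex scaled to have coordinate 1 at [w], so that its coordinate at [v]
    is the gain. *)
Definition link_vec v w a : V := a *: unit_vec F v + unit_vec F w.

Lemma link_vec_coef v w a u :
  (link_vec v w a)@_u = a * (v == u)%:R + (w == u)%:R.
Proof. by rewrite mcoeffD mcoeffZ !mcoeff_unit_vec. Qed.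

Lemma link_vec_l v w a : v != w -> (link_vec v w a)@_v = a.
Proof. by move=> vw; rewrite link_vec_coef eqxx [w == v]eq_sym (negPf vw) mulr1 addr0. Qed.

Lemma link_vec_r v w a : v != w -> (link_vec v w a)@_w = 1.
Proof. by move=> vw; rewrite link_vec_coef eqxx (negPf vw) mulr0 add0r. Qed.

Lemma link_vec_hyp v w a : v != w -> link_hyp v w a (link_vec v w a).
Proof. by move=> vw; rewrite /link_hyp /= link_vec_l // link_vec_r // mul1r. Qed.

Lemma lineE v w : line v w = [set x | forall u, u != v -> u != w -> x@_u = 0].
Proof.
apply/seteqP; split.
  apply: smallest_sub.
    split=> [u _ _|a x y Lx Ly u uv uw]; first exact: mcoeff0.
    by rewrite mcoeffD mcoeffZ Lx // Ly // mulr0 addr0.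
  move=> x [_ [|] -> [a ->]] u uv uw; rewrite mcoeffZ mcoeff_unit_vec eq_sym.
    by rewrite (negPf uv) mulr0.
  by rewrite (negPf uw) mulr0.
move=> x Lx; rewrite (unit_vec_sum x); apply: subspace_sum; first exact: Span_subspace.
move=> u _; have [->|uv] := eqVneq u v.
  by apply: (mem_Span (p := hat v)); [left|exists x@_v].
have [->|uw] := eqVneq u w.
  by apply: (mem_Span (p := hat w)); [right|exists x@_w].
by rewrite Lx // scale0r; case: (Span_subspace [set hat v; hat w]).
Qed.

Lemma link_vec_expand v w a x : v != w -> x \in line v w -> x@_v = x@_w * a ->
  x = x@_w *: link_vec v w a.
Proof.
move=> vw; rewrite inE lineE => Lx xv; apply/malgP => u.
rewrite mcoeffZ link_vec_coef mulrDr mulrA -xv.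
have [<-|vu] := eqVneq v u; first by rewrite eq_sym (negPf vw) !mulr0 addr0 mulr1.
have [<-|wu] := eqVneq w u; first by rewrite !mulr0 add0r mulr1.
by rewrite Lx ?[u == _]eq_sym // !mulr0 addr0.
Qed.

(** A point of the line other than the two unit points has both coordinates nonzero and can be
    scaled to coordinate 1 at [w]. *)
Lemma link_apexP v w p :
  link_apex v w p <->
  v != w /\ exists2 a, a != 0 & p = point_of (link_vec v w a).
Proof.
split=> [[/eqP vw [x x0 ->] pL pN]|[vw [a a0 ->]]].
  split=> //; have Lx : line v w x by apply: pL; apply: point_of_self.
  have xw : x@_w != 0.
    apply/eqP => xw; apply: pN; exists v => //.
    have ex : x = x@_v *: unit_vec F v.
      apply/malgP => u; rewrite mcoeffZ mcoeff_unit_vec.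
      have [<-|vu] := eqVneq v u; first by rewrite mulr1.
      have [<-|wu] := eqVneq w u; first by rewrite mulr0.
      by move: Lx; rewrite lineE mulr0 => ->; rewrite // eq_sym.
    rewrite ex point_ofZ //; apply: contraNneq x0 => xv.
    by rewrite ex xv scale0r.
  have xv : x@_v != 0.
    apply/eqP => xv; apply: pN; exists w => //.
    have ex : x = x@_w *: unit_vec F w.
      apply/malgP => u; rewrite mcoeffZ mcoeff_unit_vec.
      have [<-|wu] := eqVneq w u; first by rewrite mulr1.
      have [<-|vu] := eqVneq v u; first by rewrite mulr0.
      by move: Lx; rewrite lineE mulr0 => ->; rewrite // eq_sym.
    by rewrite [in RHS]ex point_ofZ.
  exists ((x@_w)^-1 * x@_v).
    by apply: skew_mul_neq0; rewrite // skew_inv_neq0.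
  have ex : x = x@_w *: link_vec v w ((x@_w)^-1 * x@_v).
    by apply: link_vec_expand; rewrite ?inE // mulrA mulrV ?skew_unit // mul1r.
  by rewrite [in LHS]ex point_ofZ.
have cw := link_vec_r a vw; have cv := link_vec_l a vw.
split; first exact/eqP.
- exists (link_vec v w a) => //; apply/eqP => l0.
  by move/eqP: cw; rewrite l0 mcoeff0 eq_sym oner_eq0.
- move=> x [b ->]; rewrite lineE => u uv uw.
  by rewrite mcoeffZ link_vec_coef ![_ == u]eq_sym (negPf uv) (negPf uw) mulr0 addr0 mulr0.
(* A vector of [hat u] vanishes off [u], whereas this one is nonzero at both [v] and [w]. *)
move=> [u _ eu]; have [b eb] : hat u (link_vec v w a) by rewrite eu; apply: point_of_self.
have c (y : N) : y != u -> (link_vec v w a)@_y = 0.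
  by move=> yu; rewrite eb mcoeffZ mcoeff_unit_vec eq_sym (negPf yu) mulr0.
have vu : v = u by apply/eqP; apply: contraNT a0 => /c; rewrite cv => ->.
have wu : w = u by apply/eqP; apply/negPn/negP => /c/eqP; rewrite cw oner_eq0.
by rewrite vu wu eqxx in vw.
Qed.

(** For [x] on the hyperplane, subtracting [x_w] times the apex vector kills both coordinates [v]
    and [w]; the rest is spanned by the other unit vectors. *)
Lemma Span_link_vec v w a : v != w -> a != 0 ->
  Span ((hatN `\` [set hat v; hat w]) `|` [set point_of (link_vec v w a)])
  = link_hyp v w a.
Proof.
move=> vw a0; apply/seteqP; split.
  apply: smallest_sub; first exact: link_hyp_subspace.
  move=> x [_ [[[u _ <-] ne]|->] [b ->]]; rewrite /link_hyp /= !mcoeffZ.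
    rewrite !mcoeff_unit_vec; case: eqP => [uv|_]; first by case: ne; left; rewrite uv.
    by case: eqP => [uw|_]; [case: ne; right; rewrite uw|rewrite mulr0 mul0r].
  by rewrite link_vec_l // link_vec_r // mulr1.
move=> x xvw; rewrite -(subrK (x@_w *: link_vec v w a) x).
set Sp := Span _; have subS : is_subspace Sp by apply: Span_subspace.
apply: (subspaceD subS); last first.
  by apply: (mem_Span (p := point_of (link_vec v w a))); [right|exists x@_w].
set y := x - _.
have yv : y@_v = 0.
  by rewrite /y mcoeffB mcoeffZ link_vec_l // xvw subrr.
have yw : y@_w = 0.
  by rewrite /y mcoeffB mcoeffZ link_vec_r // mulr1 subrr.
rewrite (unit_vec_sum y); apply: subspace_sum => // u _.
have [->|/eqP uv] := eqVneq u v; first by rewrite yv scale0r; case: subS.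
have [->|/eqP uw] := eqVneq u w; first by rewrite yw scale0r; case: subS.
apply: (mem_Span (p := hat u)); last by exists y@_u.
by left; split; [exists u|case=> /hat_inj].
Qed.

(** The unit vectors missing from a hyperplane reveal its nodes; this separates hyperplanes of
    different kinds or on different nodes. *)
Lemma zero_hyp_unit v u : zero_hyp v (unit_vec F u) <-> u <> v.
Proof.
rewrite /zero_hyp /= mcoeff_unit_vec; case: eqP => [->|//]; split=> [/eqP|//].
by rewrite oner_eq0.
Qed.

Lemma link_hyp_unit v w a u : v != w -> a != 0 ->
  link_hyp v w a (unit_vec F u) <-> u <> v /\ u <> w.
Proof.
move=> vw a0; rewrite /link_hyp /= !mcoeff_unit_vec.
have [->|/eqP uv] := eqVneq u v.
  by rewrite (negPf vw) mul0r; split=> [/eqP|[]//]; rewrite oner_eq0.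
have [->|/eqP uw] := eqVneq u w; last by rewrite mul0r.
by rewrite mul1r; split=> [/esym/eqP|[]//]; rewrite (negPf a0).
Qed.

Lemma zero_hyp_inj : injective zero_hyp.
Proof.
move=> u v euv; apply: contrapT => uv.
have : zero_hyp u (unit_vec F u) by rewrite euv; apply/zero_hyp_unit.
by move/zero_hyp_unit.
Qed.

Lemma zero_hyp_neq_link u v w a : v != w -> a != 0 -> zero_hyp u <> link_hyp v w a.
Proof.
move=> vw a0 e.
have nv : ~ zero_hyp u (unit_vec F v) by rewrite e => /(link_hyp_unit _ vw a0)[].
have nw : ~ zero_hyp u (unit_vec F w) by rewrite e => /(link_hyp_unit _ vw a0)[].
have vu : v = u by apply: contrapT => /zero_hyp_unit.
have wu : w = u by apply: contrapT => /zero_hyp_unit.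
by rewrite vu wu eqxx in vw.
Qed.

Lemma link_hyp_nodes v w a v' w' a' : v != w -> v' != w' -> a != 0 -> a' != 0 ->
  link_hyp v w a = link_hyp v' w' a' -> (v' = v /\ w' = w) \/ (v' = w /\ w' = v).
Proof.
move=> vw vw' a0 a0' e.
have n u : u = v' \/ u = w' -> u = v \/ u = w.
  move=> h; apply: contrapT => h'.
  have : link_hyp v w a (unit_vec F u).
    by apply/link_hyp_unit => //; split=> ?; apply: h'; [left|right].
  by rewrite e => /(link_hyp_unit _ vw' a0')[]; case: h.
have [] := n v' (or_introl erefl); have [] := n w' (or_intror erefl) => ew ev; auto.
  by rewrite ev ew eqxx in vw'.
by rewrite ev ew eqxx in vw'.
Qed.

(** The apex vector of gain [a] serves as test vector. *)
Lemma link_hyp_gain v w a b : v != w -> link_hyp v w a = link_hyp v w b -> a = b.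
Proof.
move=> vw e; have := link_vec_hyp a vw.
by rewrite e /link_hyp /= link_vec_l // link_vec_r // mul1r.
Qed.

Lemma link_hyp_sym v w a : a != 0 -> link_hyp w v a^-1 = link_hyp v w a.
Proof.
move=> a0; apply/seteqP; split=> x; rewrite /link_hyp /= => ->.
  by rewrite divrK // skew_unit.
by rewrite mulrK // skew_unit.
Qed.

(** * Apical hyperplanes computed from their apices *)

Lemma apical_hat v : apical (hat v) = zero_hyp v.
Proof.
apply: xget_unique; first by left; exists v; rewrite ?coord_hypE.
move=> H [[u /hat_inj<- ->]|[u [w [[_ _ _ []]]]]]; first by rewrite coord_hypE.
by exists v.
Qed.

(** The choice made by [apical] is determined because any other description of the apex uses the
    same two nodes, with gain [a] or, in reverse order, [a^-1]. *)
Lemma apical_link v w a : v != w -> a != 0 ->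
  apical (point_of (link_vec v w a)) = link_hyp v w a.
Proof.
move=> vw a0; have lap : link_apex v w (point_of (link_vec v w a)).
  by apply/link_apexP; split=> //; exists a.
apply: xget_unique.
  by right; exists v, w; rewrite Span_link_vec.
move=> H [[u e _]|[v' [w' [/link_apexP[vw' [a' a0' e]] ->]]]].
  by case: lap => _ _ _ []; exists u.
rewrite e Span_link_vec //.
have [b eb] : point_of (link_vec v' w' a') (link_vec v w a).
  by rewrite -e; apply: point_of_self.
have cw := link_vec_r a vw; have cv := link_vec_l a vw.
have n u : (link_vec v w a)@_u != 0 -> u = v' \/ u = w'.
  rewrite eb mcoeffZ link_vec_coef; have [->|vu] := eqVneq v' u; first by left.
  have [->|wu] := eqVneq w' u; first by right.
  by rewrite mulr0 addr0 mulr0 eqxx.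
have hyp : link_hyp v' w' a' (link_vec v w a).
  rewrite eb; apply: subspaceZ; first exact: link_hyp_subspace.
  exact: link_vec_hyp.
have [] : v = v' \/ v = w' by apply: n; rewrite cv.
  move=> vv; have [ww|ww] : w = v' \/ w = w' by apply: n; rewrite cw oner_eq0.
    by rewrite vv ww eqxx in vw.
  subst v' w'; move: hyp; rewrite /link_hyp /= cv cw mul1r => <- //.
(* Reverse order: the equation at the apex vector reads [1 = a * a']. *)
move=> vv; have [ww|ww] : w = v' \/ w = w' by apply: n; rewrite cw oner_eq0.
  subst v' w'; move: hyp; rewrite {1}/link_hyp /= cv cw => h.
  rewrite -(link_hyp_sym v w a0); congr link_hyp.
  by rewrite -[a'](mulKr (skew_unit hF a0)) -h mulr1.
by rewrite vv ww eqxx in vw.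
Qed.

(** If [a] is not [-1], the normalizing scalar is nonzero and does not move the point. If [a = -1],
    then [h_inf] meets the line in [x_v + x_w = 0], the equation of gain [-1]. *)
Lemma link_pointE v w a : v != w -> a != 0 ->
  link_point v w a = point_of (link_vec v w a).
Proof.
move=> vw a0; rewrite /link_point; case: eqP => [->|an1]; last first.
  rewrite point_ofZ // skew_inv_neq0 // addrC addr_eq0; exact/eqP.
have hinf x : line v w x -> h_inf x <-> x@_v = x@_w * -1.
  rewrite lineE => Lx.
  suff e : \sum_(u <- msupp x) x@_u = x@_v + x@_w.
    rewrite /h_inf /= e mulrN1; split=> [/eqP|->]; last by rewrite addNr.
    by rewrite addr_eq0 => /eqP.
  (* The support of [x] may miss [v] or [w], so both sums are padded with zeros to a common index
     set. *)
  pose D := (msupp x `|` [fset v; w])%fset.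
  have -> : \sum_(u <- msupp x) x@_u = \sum_(u <- D) x@_u.
    apply: big_fset_incl; first exact: fsubsetUl.
    by move=> u _; apply: mcoeff_outdom.
  have -> : \sum_(u <- D) x@_u = \sum_(u <- [fset v; w]%fset) x@_u.
    apply/esym/big_fset_incl; first exact: fsubsetUr.
    by move=> u _; rewrite !inE negb_or => /andP[uv uw]; apply: Lx.
  by rewrite big_fsetU1 ?big_seq_fset1 // inE.
apply/seteqP; split=> x.
  move=> [/[swap] Lx /(hinf _ Lx) xv]; exists x@_w.
  by apply: link_vec_expand; rewrite ?inE.
have [_ _ Lp _] : link_apex v w (point_of (link_vec v w (-1))).
  by apply/link_apexP; split=> //; exists (-1); rewrite ?oppr_eq0 ?oner_eq0.
move=> px; have Lx := Lp _ px; split=> //; apply/hinf => //.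
by case: px => b ->; rewrite !mcoeffZ link_vec_l // link_vec_r // mulr1.
Qed.

End Hyperplanes.

(** * Walks and connected components *)

Section Walks.
Local Open Scope ring_scope.

Variables (N E : choiceType) (G : graph N E).
Implicit Types (v w : N) (e : E) (p q : seq (E * N)).

Lemma walk_cat v p q : walk G v (p ++ q) <-> walk G v p /\ walk G (walk_end v p) q.
Proof.
elim: p v => [|[e w] p IHp] v /=; first by split=> [|[]].
split=> [[Ge vw /IHp[]]|[[Ge vw wp] wq]]; first by [].
by split=> //; apply/IHp.
Qed.

Lemma walk_end_cat v p q : walk_end v (p ++ q) = walk_end (walk_end v p) q.
Proof. by rewrite /walk_end /unzip2 map_cat last_cat. Qed.

Lemma walk_edges v p : walk G v p -> forall e, e \in unzip1 p -> edges G e.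
Proof.
elim: p v => // -[e w] p IHp v /= [Ge _ wp] e'; rewrite inE => /predU1P[->//|].
exact: IHp wp e'.
Qed.

Lemma walk_end_in v p : p != [::] -> walk_end v p \in unzip2 p.
Proof. by case: p => // -[e w] p _; rewrite /walk_end /= mem_last. Qed.

Hypothesis hG : is_graph G.

Lemma joins_neq e v w : edges G e -> joins G e v w -> v != w.
Proof.
move=> Ge vw; case: (hG Ge) => [[_ /(_ v w)]//|[[a [b [ab J]]] _]].
by case/J: vw => -[-> ->]; apply/eqP => // /esym.
Qed.

Lemma joins_sym e v w : edges G e -> joins G e v w -> joins G e w v.
Proof.
move=> Ge vw; case: (hG Ge) => [[_ /(_ v w)]//|[[a [b [ab J]]] _]].
by apply/J; case/J: vw => -[-> ->]; auto.
Qed.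

Lemma joins_eq e v w x y : edges G e -> joins G e v w -> joins G e x y ->
  (x = v /\ y = w) \/ (x = w /\ y = v).
Proof.
move=> Ge vw; case: (hG Ge) => [[_ /(_ v w)]//|[[a [b [ab J]]] _]].
by case/J: vw => -[-> ->]; case/J => -[-> ->]; auto.
Qed.

Lemma half_not_joins e v x y : edges G e -> half_at G e v -> ~ joins G e x y.
Proof. by move=> Ge hv; case: (hG Ge) => [[_]|[_ /(_ v)]]//. Qed.

Lemma half_at_eq e v x : edges G e -> half_at G e v -> half_at G e x -> x = v.
Proof.
move=> Ge hv; case: (hG Ge) => [[[u U] _]|[_ /(_ v)]]//.
by move/U: hv => -> /U.
Qed.

Lemma edge_cases e : edges G e ->
  (exists v, half_at G e v) \/ (exists v w, joins G e v w).
Proof.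
move=> Ge; case: (hG Ge) => [[[v V] _]|[[v [w [_ J]]] _]].
  by left; exists v; apply/V.
by right; exists v, w; apply/J; left.
Qed.

Lemma connected_by_trans S x y z :
  connected_by G S x y -> connected_by G S y z -> connected_by G S x z.
Proof.
move=> [p [wp ep sp]] [q [wq eq sq]]; exists (p ++ q); split.
- by apply/walk_cat; rewrite ep.
- by rewrite walk_end_cat ep.
by move=> e; rewrite /unzip1 map_cat mem_cat => /orP[/sp|/sq].
Qed.

Lemma connected_by_refl S x : connected_by G S x x.
Proof. by exists [::]. Qed.

Lemma connected_by_joins (S : {fset E}) e x y : e \in S -> edges G e -> joins G e x y ->
  connected_by G S x y.
Proof.
by move=> Se Ge xy; exists [:: (e, y)]; split=> // e'; rewrite inE => /eqP->.
Qed.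

Lemma connected_by_sym S x y : connected_by G S x y -> connected_by G S y x.
Proof.
move=> [p [wp <- sp]] {y}; elim: p x wp sp => [|[e w] p IHp] x /=.
  by move=> _ _; apply: connected_by_refl.
move=> [Ge xw wp] sp; apply: (@connected_by_trans _ _ w).
  by apply: IHp => // e' e'p; apply: sp; rewrite inE e'p orbT.
by apply: (@connected_by_joins _ e) => //; [apply: sp; rewrite inE eqxx|apply: joins_sym].
Qed.

Lemma eq_component S x y : connected_by G S x y ->
  [set z | connected_by G S x z]%classic = [set z | connected_by G S y z]%classic.
Proof.
move=> xy; apply/seteqP; split=> z /=; apply: connected_by_trans => //.
exact: connected_by_sym.
Qed.

Lemma node_set_connected (S : {fset E}) x y : ([set` S] `<=` edges G)%classic ->
  connected_by G S x y -> node_set G S x -> node_set G S y.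
Proof.
move=> SG [p [wp <- sp]] {y}; elim: p x wp sp => [//|[e w] p IHp] x /= [Ge xw wp] sp Sx.
apply: IHp => // [e' e'p|]; first by apply: sp; rewrite inE e'p orbT.
exists e; first by apply: sp; rewrite inE eqxx.
by right; exists x; apply: joins_sym.
Qed.

Lemma finite_node_set (S : {fset E}) : ([set` S] `<=` edges G)%classic ->
  finite_set (node_set G S).
Proof.
move=> SG; have -> : node_set G S = (\bigcup_(e in [set` S]) [set v | incident G e v])%classic.
  by apply/seteqP; split=> v [e]; exists e.
apply: bigcup_finite => // e /SG Ge; case: (edge_cases Ge) => [[v hv]|[v [w vw]]].
  apply: (@sub_finite_set _ _ [set v]%classic) => // x [hx|[y xy]].
    exact: half_at_eq Ge hv hx.
  by case: (half_not_joins Ge hv xy).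
apply: (@sub_finite_set _ _ [set v; w]%classic) => // x [hx|[y xy]].
  by case: (half_not_joins Ge hx vw).
by case: (joins_eq Ge vw xy) => -[-> _]; [left|right].
Qed.

(** Every node that the walk visits is connected to [v] by [S], hence in [X], so each edge crossed
    touches [X]. *)
Lemma walk_edges_in (S : {fset E}) v p X : {subset unzip1 p <= S} ->
  walk G v p -> (forall y, connected_by G S v y -> X y) ->
  {subset unzip1 p <= edges_in G S X}.
Proof.
elim: p v => // -[e w] p IHp v sp /= [Ge vw wp] hX e'; rewrite inE => /predU1P[->|].
  rewrite !inE sp ?inE ?eqxx //=; exists v.
    exact/hX/connected_by_refl.
  by right; exists w.
apply: IHp wp _ e' => [e' e'p|y wy]; first by apply: sp; rewrite inE e'p orbT.
apply: hX; apply: connected_by_trans wy.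
by apply: (@connected_by_joins _ e) => //; apply: sp; rewrite inE eqxx.
Qed.

End Walks.

(** * Repetitions in a sequence, for cutting walks at a repeated node or edge *)

Lemma not_uniq_map_split (T : Type) (U : eqType) (f : T -> U) (p : seq T) :
  ~~ uniq (map f p) ->
  exists p1 a p2 b p3, p = p1 ++ a :: p2 ++ b :: p3 /\ f a = f b.
Proof.
elim: p => //= a p IHp; rewrite negb_and negbK => /orP[|/IHp].
  move=> fa; have : exists p2 b p3, p = p2 ++ b :: p3 /\ f a = f b.
    elim: p fa {IHp} => //= b p IHp; rewrite inE => /predU1P[->|/IHp].
      by exists [::], b, p.
    by move=> [p2 [c [p3 [-> fc]]]]; exists (b :: p2), c, p3.
  by move=> [p2 [b [p3 [-> fb]]]]; exists [::], a, p2, b, p3.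
by move=> [p1 [b [p2 [c [p3 [-> bc]]]]]]; exists (a :: p1), b, p2, c, p3.
Qed.

Lemma uniq_cat2 (T : eqType) (s1 s2 s3 : seq T) x y :
  uniq (s1 ++ x :: s2 ++ y :: s3) ->
  [/\ x != y, x \notin s2, y \notin s1 & y \notin s3].
Proof.
rewrite cat_uniq /= has_cat /= !(mem_cat, inE) !negb_or cat_uniq /=.
case/and4P=> _ /and4P[_ _ ys1 _] /and3P[xs2 xy _] /and4P[_ _ ys3 _].
by split.
Qed.

(** * Hyperplanes of the edges of a gain graph *)

Section Gains.
Local Open Scope classical_set_scope.
Local Open Scope ring_scope.

Variables (F : unitRingType) (hF : GRing.field_axiom F) (N E : choiceType).
Variables (P : gain_graph F N E) (hP : is_gain_graph P).
Local Notation G := (gg_graph P).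
Let hG : is_graph G := proj1 hP.
Implicit Types (v w : N) (e : E) (p q : seq (E * N)) (S C : {fset E}).

Lemma gain_neq0 e v w : edges G e -> joins G e v w -> gain P e v w != 0.
Proof. by move=> Ge vw; have [] := hP.2 _ _ _ Ge vw. Qed.

Lemma gain_sym e v w : edges G e -> joins G e v w -> gain P e w v = (gain P e v w)^-1.
Proof. by move=> Ge vw; have [] := hP.2 _ _ _ Ge vw. Qed.

Lemma edge_hyp_half e v : edges G e -> half_at G e v -> edge_hyp P e = zero_hyp v.
Proof.
move=> Ge hv; rewrite /edge_hyp (_ : edge_point P e = @hat F N v) ?apical_hat //.
apply: xget_unique; first by left; exists v.
move=> p [[w hw ->]|[x [y [xy _]]]]; first by rewrite (half_at_eq hG Ge hv hw).
by case: (half_not_joins hG Ge hv xy).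
Qed.

Lemma edge_hyp_link e v w : edges G e -> joins G e v w ->
  edge_hyp P e = link_hyp v w (gain P e v w).
Proof.
move=> Ge vw; have nvw := joins_neq hG Ge vw; have g0 := gain_neq0 Ge vw.
rewrite /edge_hyp (_ : edge_point P e = point_of (link_vec v w (gain P e v w))).
  exact: apical_link.
apply: xget_unique; first by right; exists v, w; rewrite link_pointE.
move=> p [[u hu _]|[x [y [xy ->]]]]; first by case: (half_not_joins hG Ge hu vw).
case: (joins_eq hG Ge vw xy) => -[-> ->]; first by rewrite link_pointE.
have nwv : w != v by rewrite eq_sym.
rewrite (gain_sym Ge vw) (link_pointE hF nwv (skew_inv_neq0 hF g0)).
(* Reversing the link rescales the apex vector, so both orientations specify one point. *)
have -> : link_vec w v (gain P e v w)^-1 = (gain P e v w)^-1 *: link_vec v w (gain P e v w).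
  by rewrite /link_vec scalerDr scalerA mulVr ?skew_unit // scale1r addrC.
by rewrite point_ofZ // skew_inv_neq0.
Qed.

(** * Gains of walks and potentials *)

Lemma walk_gain_cat v p q :
  walk_gain P v (p ++ q) = walk_gain P (walk_end v p) q * walk_gain P v p.
Proof.
elim: p v => [|[e w] p IHp] v /=; first by rewrite mulr1.
by rewrite IHp mulrA.
Qed.

Lemma walk_gain_neq0 v p : walk G v p -> walk_gain P v p != 0.
Proof.
elim: p v => [|[e w] p IHp] v /=; first by rewrite oner_neq0.
by move=> [Ge vw wp]; apply: skew_mul_neq0 => //; [apply: IHp|apply: gain_neq0].
Qed.

(* The model is the coordinate function of a vector lying on the hyperplanes of
   the links in S. *)
Definition potential S (g : N -> F) : Prop :=
  forall e v w, e \in S -> joins G e v w -> g v = g w * gain P e v w.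

Lemma potential_walk S g v p : potential S g -> walk G v p -> {subset unzip1 p <= S} ->
  g v = g (walk_end v p) * walk_gain P v p.
Proof.
move=> gS; elim: p v => [|[e w] p IHp] v /=; first by rewrite mulr1.
move=> [Ge vw wp] sp; rewrite (gS e v w) //; last by apply: sp; rewrite inE eqxx.
by rewrite [g w]IHp // ?mulrA // => e' e'p; apply: sp; rewrite inE e'p orbT.
Qed.

Lemma edge_hyp_potential S (x : {malg F[N]}) : [set` S] `<=` edges G ->
  (forall e, e \in S -> edge_hyp P e x) -> potential S (fun v => x@_v).
Proof. by move=> SG Sx e v w Se vw; move: (Sx e Se); rewrite (edge_hyp_link (SG _ Se) vw). Qed.

(** Induction on length. A closed walk repeating a node contains a shorter closed walk that can be
    excised; one repeating only an edge goes along it and straight back. *)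
Lemma closed_walk_gain S : [set` S] `<=` edges G ->
  (forall v p, circle_walk G v p -> {subset unzip1 p <= S} -> walk_gain P v p = 1) ->
  forall v p, walk G v p -> walk_end v p = v -> {subset unzip1 p <= S} ->
  walk_gain P v p = 1.
Proof.
move=> SG circS v p; have [n] := ubnP (size p); elim: n v p => // n IHn v p.
rewrite ltnS => le_pn wp ep sp.
have [->//|p0] := eqVneq p [::].
have [u2|] := boolP (uniq (unzip2 p)); last first.
  move=> /not_uniq_map_split[p1 [[e1 w1] [p2 [[e2 w2] [p3 [defp /= e12]]]]]]; subst w2.
  (* The middle piece is closed at [w1], and the outer pieces join there into another closed walk;
     both are shorter than [p]. *)
  have {}defp : p = (p1 ++ [:: (e1, w1)]) ++ (p2 ++ [:: (e2, w1)]) ++ p3.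
    by rewrite defp -!catA.
  move: wp ep sp le_pn; rewrite {p0}defp; set q1 := p1 ++ _; set q2 := p2 ++ _.
  have eq1 : walk_end v q1 = w1 by rewrite walk_end_cat.
  have eq2 : walk_end w1 q2 = w1 by rewrite walk_end_cat.
  have sq1 : (0 < size q1)%N by rewrite size_cat addn1.
  have sq2 : (0 < size q2)%N by rewrite size_cat addn1.
  clearbody q1 q2.
  move=> /walk_cat[wq1]; rewrite eq1 => /walk_cat[wq2]; rewrite eq2 => wp3.
  rewrite !walk_end_cat eq1 eq2 => ep sp le_pn.
  rewrite !walk_gain_cat eq1 eq2 (IHn w1 q2) ?mulr1 //.
  - have := IHn v (q1 ++ p3); rewrite walk_gain_cat eq1; apply.
    + by apply: leq_trans le_pn; rewrite !size_cat; lia.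
    + by apply/walk_cat; rewrite eq1.
    + by rewrite walk_end_cat eq1.
    + move=> e; rewrite /unzip1 map_cat mem_cat => h; apply: sp.
      by rewrite /unzip1 !map_cat !mem_cat; case/orP: h => ->; rewrite ?orbT.
  - by apply: leq_trans le_pn; rewrite !size_cat; lia.
  - move=> e h; apply: sp.
    by rewrite /unzip1 map_cat mem_cat map_cat mem_cat [X in _ || (X || _)]h orbT.
have [u1|] := boolP (uniq (unzip1 p)); first by apply: circS.
move=> /not_uniq_map_split[p1 [[e w1] [p2 [[e2 w2] [p3 [defp /= e12]]]]]]; subst e2.
subst p; move: u2; rewrite /unzip2 !map_cat /= map_cat => /uniq_cat2[nw12 np2w1 np1w2 np3w2].
move: wp => /walk_cat[wp1 /= [Ge j1 /walk_cat[wp2 /= [_ j2 wp3]]]].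
(* Crossing [e] twice in the same direction would reach one node twice, so the directions are
   opposite. Distinctness of the nodes then empties [p1], [p2] and [p3]. *)
have w1e : walk_end w1 p2 = w1 /\ w2 = walk_end v p1.
  by case: (joins_eq hG Ge j1 j2) => -[-> ew] //; rewrite ew eqxx in nw12.
have p20 : p2 = [::].
  by apply/eqP; apply: contraNT np2w1 => /(walk_end_in w1); rewrite w1e.1.
subst p2.
have p10 : p1 = [::].
  by apply/eqP; apply: contraNT np1w2 => /(walk_end_in v); rewrite -w1e.2.
subst p1; have w2v : w2 = v := w1e.2.
have p30 : p3 = [::].
  apply/eqP; apply: contraNT np3w2 => /(walk_end_in w2).
  by rewrite [walk_end w2 p3]ep w2v.
rewrite p30 w2v /= mul1r (gain_sym Ge j1) mulVr // skew_unit //.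
exact: gain_neq0.
Qed.

Lemma walk_nodes v p e x y : walk G v p -> e \in unzip1 p -> joins G e x y ->
  x \in v :: unzip2 p.
Proof.
elim: p v => // -[e' w] p IHp v /= [Ge vw wp]; rewrite inE => /predU1P[->|ep] xy.
  by case: (joins_eq hG Ge vw xy) => -[-> _]; rewrite !inE eqxx ?orbT.
by rewrite inE IHp ?orbT.
Qed.

Lemma walk_edge_joins v p e : walk G v p -> e \in unzip1 p -> exists x y, joins G e x y.
Proof.
elim: p v => // -[e' w] p IHp v /= [Ge vw wp]; rewrite inE => /predU1P[->|ep].
  by exists v, w.
exact: IHp wp ep.
Qed.

Lemma unzip2_rcons p e w : unzip2 (p ++ [:: (e, w)]) = rcons (unzip2 p) w.
Proof. by rewrite cats1 /unzip2 map_rcons. Qed.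

Lemma mem_edge_set p e : (e \in edge_set p) = (e \in unzip1 p).
Proof. by rewrite inE. Qed.

(** One orientation of the new edge suffices, since the reverse gain is the inverse. *)
Lemma potential_add_edge (g : N -> F) S S' e u w : potential S g -> edges G e ->
  joins G e u w -> g u = g w * gain P e u w ->
  (forall e', e' \in S' -> e' = e \/ e' \in S) -> potential S' g.
Proof.
move=> gS Ge uw gu sS e' x y /sS[->|]; last exact: gS.
case/(joins_eq hG Ge uw) => -[-> ->] //.
by rewrite gu (gain_sym Ge uw) mulrK // skew_unit // gain_neq0.
Qed.

(** Built from the start of the path: each new node is off the earlier path, so its value is free to
    satisfy the equation of the last edge. *)
Lemma path_potential v p : walk G v p -> uniq (v :: unzip2 p) ->
  exists g, potential (edge_set p) g /\ g v = 1.
Proof.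
elim/last_ind: p => [_ _|p [e w] IHp].
  by exists (fun=> 1); split=> // e x y; rewrite mem_edge_set.
rewrite -cats1 unzip2_rcons -rcons_cons rcons_uniq.
move=> /walk_cat[wp [Ge uw _]] /andP[nw un].
have [g [gS gv]] := IHp wp un; set u := walk_end v p in uw.
pose g' y := if y == w then g u * (gain P e u w)^-1 else g y.
have g'E y : y != w -> g' y = g y by rewrite /g' => /negPf->.
have gp : potential (edge_set p) g'.
  move=> e' x y; rewrite mem_edge_set => ep xy.
  have Ge' := walk_edges wp ep.
  have yx := joins_sym hG Ge' xy.
  have xw : x != w by apply: contraNneq nw => <-; exact: walk_nodes wp ep xy.
  have yw : y != w by apply: contraNneq nw => <-; exact: walk_nodes wp ep yx.
  by rewrite (g'E x xw) (g'E y yw); apply: gS => //; rewrite mem_edge_set.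
have g0 := gain_neq0 Ge uw.
exists g'; split; last first.
  by rewrite g'E //; apply: contraNneq nw => ->; rewrite inE eqxx.
apply: (potential_add_edge gp Ge uw) => [|e'].
  by rewrite g'E ?(joins_neq hG Ge) // /g' eqxx divrK // skew_unit.
by rewrite !mem_edge_set /unzip1 map_cat mem_cat inE => /orP[->|/eqP->]; [right|left].
Qed.

(** Without its last edge the circle is a path, which carries a potential; gain 1 is what the
    closing edge requires of it. *)
Lemma circle_potential v p : circle_walk G v p -> walk_gain P v p = 1 ->
  exists g, potential (edge_set p) g /\ g v = 1.
Proof.
case: (lastP p) => [[]//|{}p [e w]]; rewrite -cats1 => -[+ + _].
rewrite walk_end_cat /= => + e_w; rewrite /walk_end /= in e_w; subst w.
move=> /walk_cat[wp /= [Ge uv _]]; rewrite unzip2_rcons rcons_uniq => un _.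
rewrite walk_gain_cat /= mul1r; set u := walk_end v p in uv * => gp1.
have [g [gS gv]] := path_potential wp un.
exists g; split=> //; apply: (potential_add_edge gS Ge uv) => [|e'].
  rewrite gv mul1r; have U := skew_unit hF (walk_gain_neq0 wp).
  apply: (mulIr U); rewrite gp1 -gv; apply/esym/(potential_walk gS wp).
  by move=> e'; rewrite mem_edge_set.
by rewrite !mem_edge_set /unzip1 map_cat mem_cat inE => /orP[->|/eqP->]; [right|left].
Qed.

Lemma potential_neq0 v p S (g : N -> F) : potential S g -> walk G v p ->
  {subset unzip1 p <= S} -> g v != 0 -> forall y, y \in v :: unzip2 p -> g y != 0.
Proof.
move=> gS; elim: p v => [|[e w] p IHp] v /=.
  by move=> _ _ gv y; rewrite inE => /eqP->.
move=> [Ge vw wp] sp gv y; rewrite inE => /predU1P[->//|]; apply: IHp => //.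
  by move=> e' e'p; apply: sp; rewrite inE e'p orbT.
apply: contraNneq gv => gw; rewrite (gS e v w) ?gw ?mul0r //.
by apply: sp; rewrite inE eqxx.
Qed.

(** As gains are invertible, the value at one node determines the value at the next; left factors
    pass through since gains act on the right. *)
Lemma potential_unique v p S (f g : N -> F) c : potential S f -> potential S g ->
  walk G v p -> {subset unzip1 p <= S} -> f v = c * g v ->
  forall y, y \in v :: unzip2 p -> f y = c * g y.
Proof.
move=> fS gS; elim: p v => [|[e w] p IHp] v /=.
  by move=> _ _ fv y; rewrite inE => /eqP->.
move=> [Ge vw wp] sp fv y; rewrite inE => /predU1P[->//|]; apply: IHp => //.
  by move=> e' e'p; apply: sp; rewrite inE e'p orbT.
have Se : e \in S by apply: sp; rewrite inE eqxx.
apply: (mulIr (skew_unit hF (gain_neq0 Ge vw))).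
by rewrite -mulrA -(fS e v w) // -(gS e v w).
Qed.

(** A potential depends on the edge set alone. Going around by [p'] gives
    [g v' = g v' * walk_gain P v' p'], with [g v'] nonzero. *)
Lemma circle_gain1 v p v' p' : circle_walk G v p -> walk_gain P v p = 1 ->
  circle_walk G v' p' -> edge_set p' = edge_set p -> walk_gain P v' p' = 1.
Proof.
move=> cp gp [wp' ep' p'0 _ _] epp.
have [g [gS gv]] := circle_potential cp gp; have [wp _ _ _ _] := cp.
have gv' : g v' != 0.
  apply: (@potential_neq0 v p _ g gS) => //; first by move=> e; rewrite mem_edge_set.
    by rewrite gv oner_neq0.
  case: p' wp' p'0 epp {ep'} => // -[e w] p' /= [Ge vw _] _ epp.
  by apply: walk_nodes wp _ vw; rewrite -mem_edge_set -epp mem_edge_set inE eqxx.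
have sub : {subset unzip1 p' <= edge_set p} by move=> e; rewrite -epp mem_edge_set.
have := potential_walk gS wp' sub; rewrite ep' -{1}[g v']mulr1.
by move/(mulrI (skew_unit hF gv')).
Qed.

(** * Intersections of edge hyperplanes; the case of a circle *)

Definition solutions S : set {malg F[N]} :=
  [set x | forall e, e \in S -> edge_hyp P e x].

Lemma solutions_zero S (x : {malg F[N]}) v p : [set` S] `<=` edges G ->
  solutions S x -> walk G v p -> walk_end v p = v -> {subset unzip1 p <= S} ->
  walk_gain P v p != 1 -> x@_v = 0.
Proof.
move=> SG Sx wp ep sp g1.
have := potential_walk (edge_hyp_potential SG Sx) wp sp; rewrite ep => /eqP.
rewrite -subr_eq0 -{1}[_@_v]mulr1 -mulrBr => /eqP; apply: skew_mul_eq0 => //.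
by rewrite subr_eq0 eq_sym.
Qed.

(** A circle has as many nodes as edges. With gain 1 the coordinates on it are left multiples of a
    potential, leaving one free; otherwise all of them vanish. *)
Lemma codim_circle v p : circle_walk G v p ->
  (codim (solutions (edge_set p)) < #|` edge_set p|)%N <-> walk_gain P v p = 1.
Proof.
move=> cp; have [wp ep p0 u2 u1] := cp.
have size_es : #|` edge_set p| = size p by rewrite card_fseq undup_id // size_map.
pose D := [fset y in unzip2 p]%fset.
have DE y : (y \in D) = (y \in unzip2 p) by rewrite inE.
have size_D : #|` D| = size p by rewrite card_fseq undup_id // size_map.
have Dv : v \in D by rewrite DE -[v in v \in _]ep walk_end_in.
have consD y : (y \in v :: unzip2 p) = (y \in D).
  by rewrite inE -DE; case: eqP => // ->; rewrite Dv.
have sub : {subset unzip1 p <= edge_set p} by move=> e; rewrite mem_edge_set.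
have SG : [set` edge_set p] `<=` edges G.
  by move=> e; rewrite /= mem_edge_set; apply: walk_edges wp e.
have joinsD e x y : e \in edge_set p -> joins G e x y -> x \in D /\ y \in D.
  move=> ee xy; have yx := joins_sym hG (SG _ ee) xy; rewrite mem_edge_set in ee.
  by rewrite -!consD; split; [apply: walk_nodes wp ee xy|apply: walk_nodes wp ee yx].
have linkp e : e \in edge_set p -> exists x y, joins G e x y.
  by rewrite mem_edge_set; apply: walk_edge_joins wp.
have [g1|g1] := eqVneq (walk_gain P v p) 1; split=> // h.
- have [g [gS gv]] := circle_potential cp g1.
  have -> : solutions (edge_set p) = graph_subspace (D `\ v)%fset (fun=> v) g.
    apply/seteqP; split=> x Sx.
      move=> y; rewrite !inE => /andP[_ yp].
      apply: (potential_unique (edge_hyp_potential SG Sx) gS wp sub).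
        by rewrite gv mulr1.
      by rewrite inE [y \in unzip2 p]yp orbT.
    have {}Sx y : y \in D -> x@_y = x@_v * g y.
      have [->|yv yD] := eqVneq y v; first by rewrite gv mulr1.
      by apply: Sx; rewrite in_fsetD1 yv yD.
    move=> e ee; have [a [b ab]] := linkp e ee; have [aD bD] := joinsD _ _ _ ee ab.
    by rewrite (edge_hyp_link (SG _ ee) ab) /link_hyp /= (Sx a aD) (Sx b bD) -mulrA -(gS e).
  rewrite codim_graph_subspace //; last by move=> y _; left; rewrite !inE eqxx.
  by rewrite size_es -size_D (cardfsD1 v D) Dv.
- exfalso; move: h; have -> : solutions (edge_set p) = graph_subspace D id (fun=> 0).
    apply/seteqP; split=> x Sx.
      move=> y; rewrite -consD mulr0 => yp.
      rewrite (@potential_unique v p _ _ (fun=> 0) 0 (edge_hyp_potential SG Sx) _ wp sub) //.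
      - by rewrite mulr0.
      - by move=> e a b _ _; rewrite mul0r.
      - by rewrite mulr0; apply: (solutions_zero SG Sx wp ep sub g1).
    move=> e ee; have [a [b ab]] := linkp e ee; have [aD bD] := joinsD _ _ _ ee ab.
    by rewrite (edge_hyp_link (SG _ ee) ab) /link_hyp /= (Sx a aD) (Sx b bD) !mulr0 mul0r.
  rewrite codim_graph_subspace //; last by right.
  by rewrite size_es size_D ltnn.
- by move/eqP: g1.
Qed.

(** * Components and the rank of a finite edge set *)

Section Component.
Variables (S : {fset E}) (SG : [set` S] `<=` edges G).
Let comp x : set N := [set y | connected_by G S x y].
Let bal x := balanced_edge_set (bias_of P) (edges_in G S (comp x)).

Lemma edges_in_sub X e : e \in edges_in G S X -> e \in S.
Proof. by rewrite !inE => /andP[]. Qed.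

Lemma edges_in_component x e v : e \in edges_in G S (comp x) -> incident G e v -> comp x v.
Proof.
move=> ee iv; have Se := edges_in_sub ee; have Ge := SG Se.
move: ee; rewrite !inE => /andP[_ /asboolP[u xu iu]].
apply: (connected_by_trans xu); case: iu => [hu|[u' uu']].
  case: iv => [hv|[w vw]]; last by case: (half_not_joins hG Ge hu vw).
  by rewrite (half_at_eq hG Ge hu hv); apply: connected_by_refl.
case: iv => [hv|[w vw]]; first by case: (half_not_joins hG Ge hv uu').
case: (joins_eq hG Ge uu' vw) => -[-> _]; first exact: connected_by_refl.
exact: connected_by_joins uu'.
Qed.

(** Balance speaks of circles only; [closed_walk_gain], applied to the edges of the component,
    extends it to closed walks. *)
Lemma balanced_component_closed x : bal x ->
  forall v p, comp x v -> walk G v p -> walk_end v p = v -> {subset unzip1 p <= S} ->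
  walk_gain P v p = 1.
Proof.
move=> [_ hbal] v p xv wp ep sp.
apply: (@closed_walk_gain (edges_in G S (comp x)) _ _ v p wp ep) => [e /edges_in_sub/SG//| |].
  move=> v' p' cp' sp'.
  have [] := hbal (edge_set p').
  - by apply/fsubsetP => e; rewrite mem_edge_set; apply: sp'.
  - by exists v', p'.
  by move=> v'' [p'' [cp'' epp g1]]; apply: circle_gain1 cp'' g1 cp' epp.
apply: (walk_edges_in sp wp) => y vy; exact: connected_by_trans xv vy.
Qed.

(** One vanishing coordinate spreads through the component. If none vanished, there would be no half
    edge and every circle would have gain 1. *)
Lemma unbalanced_component_zero x y (z : {malg F[N]}) : ~ bal x -> solutions S z ->
  comp x y -> z@_y = 0.
Proof.
move=> nbal Sz xy.
suff [v xv zv] : exists2 v, comp x v & z@_v = 0.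
  have [p [wp ep sp]] := connected_by_trans (connected_by_sym hG xv) xy.
  have := potential_walk (edge_hyp_potential SG Sz) wp sp; rewrite ep zv => /esym.
  exact/skew_mul_eq0/walk_gain_neq0.
apply: contrapT => nex; apply: nbal; split=> [e v ee hv|_ /[swap] -[v [p [cp ->]]] CS].
  have Se := edges_in_sub ee.
  apply: nex; exists v; first by apply: edges_in_component ee _; left.
  by have := Sz e Se; rewrite (edge_hyp_half (SG Se) hv).
have [wp ep p0 _ _] := cp.
have sp : {subset unzip1 p <= edges_in G S (comp x)}.
  by move=> e; rewrite -mem_edge_set; apply: (fsubsetP CS).
have xv : comp x v.
  case: p wp p0 sp {cp ep CS} => // -[e w] p /= [Ge vw _] _ sp.
  by apply: (@edges_in_component x e); [apply: sp; rewrite inE eqxx|right; exists w].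
exists v, p; split=> //; apply: contrapT => /eqP g1; apply: nex; exists v => //.
by apply: solutions_zero SG Sz wp ep _ g1 => e /sp/edges_in_sub.
Qed.

(** Chosen from the component as a set, so connected nodes share their root; the default is never
    taken, as [comp x] contains [x]. *)
Let root x := xget x (comp x).

Let comp_root x : comp x (root x).
Proof. by apply: xgetPex; exists x; apply: connected_by_refl. Qed.

Let root_eq x y : comp x = comp y -> root x = root y.
Proof.
rewrite /root => ->; rewrite /xget; case: pselect => // -[]; exists y.
exact/asboolP/connected_by_refl.
Qed.

Let comp_eq x y : comp x y -> comp x = comp y.
Proof. exact: eq_component. Qed.

(** The roots of the balanced components are the free coordinates among the nodes of [S]; every
    other node is bound, by a zero factor if its component is unbalanced. *)
Lemma codim_frame :
  codim (solutions S) = mrank (frame_matroid (bias_of P)) S.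
Proof.
have /choice[wk wkP] : forall y, exists p, [/\ walk G y p, walk_end y p = root y
    & {subset unzip1 p <= S}] by move=> y; apply: comp_root.
pose t y := if `[< bal y >] then walk_gain P y (wk y) else 0.
have finNS := finite_node_set hG SG.
pose R := [set y | [/\ node_set G S y, bal y & y = root y]].
have RN : R `<=` node_set G S by move=> y [].
have finR : finite_set R by apply: sub_finite_set finNS.
have compR : balanced_components (bias_of P) S = comp @` R.
  apply/seteqP; split=> X.
    move=> [[x Sx ->] balX]; exists (root x); last by rewrite -(comp_eq (comp_root x)).
    have cr := comp_eq (comp_root x); split.
    - exact: node_set_connected (comp_root x) Sx.
    - by rewrite /bal -cr.
    - exact: root_eq.
  by move=> [x [Sx bx _] <-]; split=> //; exists x.
pose B := fset_set (node_set G S `\` R).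
have BE y : (y \in B) = (y \in node_set G S `\` R).
  by rewrite in_fset_set //; apply: finite_setD.
have rank_eq : mrank (frame_matroid (bias_of P)) S = #|` B|.
  rewrite /= /ncard compR fset_set_image // card_in_imfset /=; last first.
    move=> x y; rewrite !in_fset_set // !inE => -[_ _ ->] [_ _ ->] e.
    by apply: root_eq; rewrite (comp_eq (comp_root x)) (comp_eq (comp_root y)).
  rewrite /B fset_setD // cardfsDS //.
  by apply/fsubsetP => y; rewrite !in_fset_set // !inE; apply: RN.
rewrite rank_eq.
have -> : solutions S = graph_subspace B root t.
  apply/seteqP; split=> x Sx.
    move=> y _; rewrite /t; case: asboolP => [by_|nby].
      have [wp ep sp] := wkP y.
      by rewrite (potential_walk (edge_hyp_potential SG Sx) wp sp) ep.
    rewrite mulr0; apply: (unbalanced_component_zero nby Sx).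
    exact: connected_by_refl.
  (* At a root in [R] the chosen walk is closed, so [t y = 1] and the equation is trivial; it thus
     holds at all nodes of [S]. *)
  have {}Sx y : node_set G S y -> x@_y = x@_(root y) * t y.
    move=> Sy; have [[_ by_ ry]|nRy] := pselect (R y); last first.
      by apply: Sx; rewrite BE inE.
    have [wp ep sp] := wkP y.
    rewrite /t asboolT // (@balanced_component_closed y) //.
    - by rewrite mulr1 -ry.
    - exact: connected_by_refl.
    - by rewrite ep -ry.
  move=> e Se; have Ge := SG Se; case: (edge_cases hG Ge) => [[v hv]|[v [w vw]]].
    rewrite (edge_hyp_half Ge hv) /zero_hyp /= Sx; last by exists e => //; left.
    rewrite /t asboolF ?mulr0 // => -[/(_ e v)]; case=> //.
    rewrite !inE Se /=; apply/asboolP; exists v; last by left.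
    exact: connected_by_refl.
  have cvw : comp v w by apply: connected_by_joins vw.
  have ec := comp_eq cvw; have rvw := root_eq ec.
  have ebal : bal v = bal w by rewrite /bal ec.
  rewrite (edge_hyp_link Ge vw) /link_hyp /=.
  rewrite (Sx v); last by exists e => //; right; exists w.
  rewrite (Sx w); last by exists e => //; right; exists v; apply: joins_sym.
  rewrite -rvw -mulrA; congr (_ * _); rewrite /t -ebal.
  case: asboolP => [bv|_]; last by rewrite mul0r.
  have [wv ev sv] := wkP v; have [ww ew sw] := wkP w.
  (* Completed by [q], the chosen walk from [v] and the one through [e] and [w] are both closed of
     gain 1; cancelling the gain of [q] relates [t v] to [t w]. *)
  have [q [wq eq sq]] := connected_by_sym hG (comp_root v).
  apply: (mulrI (skew_unit hF (walk_gain_neq0 wq))).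
  have -> : walk_gain P (root v) q * walk_gain P v (wk v) = 1.
    rewrite -ev -walk_gain_cat; apply: (balanced_component_closed bv).
    - exact: connected_by_refl.
    - by apply/walk_cat; rewrite ev.
    - by rewrite walk_end_cat ev.
    - by move=> e'; rewrite /unzip1 map_cat mem_cat => /orP[/sv|/sq].
  have one : walk_gain P v ((e, w) :: wk w ++ q) = 1.
    apply: (balanced_component_closed bv).
    - exact: connected_by_refl.
    - by split=> //; apply/walk_cat; rewrite ew -rvw.
    - by rewrite -cat1s !walk_end_cat /= [walk_end w _]ew -rvw.
    - move=> e'; rewrite -cat1s /unzip1 !map_cat !mem_cat mem_seq1.
      by case/or3P=> [/eqP->|/sw|/sq].
  by rewrite -[LHS]one /= walk_gain_cat ew -rvw mulrA.
(* In a balanced component the root belongs to [R], hence is not bound. *)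
rewrite codim_graph_subspace // => y; rewrite BE inE => -[Sy nRy].
rewrite /t; case: asboolP => [by_|_]; last by right.
left; apply/negP; rewrite BE inE => -[_]; apply.
have cr := comp_eq (comp_root y); split.
- exact: node_set_connected (comp_root y) Sy.
- by rewrite /bal -cr.
- exact: root_eq.
Qed.

End Component.
End Gains.

(** * Transfer of circles along an injective edge map that fixes the nodes *)

Section CircleTransfer.
Local Open Scope classical_set_scope.

Variables (N E E' : choiceType) (G : graph N E) (G' : graph N E') (f : E -> E').
Hypothesis f_edges : forall e, edges G e -> edges G' (f e).
Hypothesis f_inj : set_inj (edges G) f.
Hypothesis f_joins : forall e v w, edges G e -> joins G e v w <-> joins G' (f e) v w.

Let fp (x : E * N) := (f x.1, x.2).

Lemma unzip2_image p : unzip2 (map fp p) = unzip2 p.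
Proof. by rewrite /unzip2 -map_comp. Qed.

Lemma unzip1_image p : unzip1 (map fp p) = map f (unzip1 p).
Proof. by rewrite /unzip1 -!map_comp. Qed.

Lemma edge_set_image p : edge_set (map fp p) = [fset f e | e in edge_set p]%fset.
Proof.
apply/fsetP => e; rewrite mem_edge_set unzip1_image.
apply/mapP/imfsetP => -[e0 h ->]; exists e0 => //; first by rewrite /= mem_edge_set.
by rewrite -mem_edge_set.
Qed.

Lemma walk_image v p : walk G v p -> walk G' v (map fp p).
Proof.
elim: p v => // -[e w] p IHp v /= [Ge vw wp]; split; [exact: f_edges| |exact: IHp].
exact/f_joins.
Qed.

Lemma walk_preimage (C : {fset E}) v q : [set` C] `<=` edges G -> walk G' v q ->
  {subset unzip1 q <= [fset f e | e in C]%fset} ->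
  exists p, [/\ walk G v p, q = map fp p & {subset unzip1 p <= C}].
Proof.
move=> CG; elim: q v => [|[e' w] q IHq] v /=; first by exists [::].
move=> [Ge' vw wq] sq.
have /imfsetP[e /= Ce defe'] : e' \in [fset f e | e in C]%fset.
  by apply: sq; rewrite inE eqxx.
have [|p [wp -> sp]] := IHq w wq; first by move=> x xq; apply: sq; rewrite inE xq orbT.
exists ((e, w) :: p); split; rewrite /= ?defe' //.
  by split=> //; [apply: CG|apply/f_joins; rewrite -?defe' //; apply: CG].
by move=> x; rewrite inE => /predU1P[->//|/sp].
Qed.

Lemma circle_walk_image v p : circle_walk G v p -> circle_walk G' v (map fp p).
Proof.
move=> [wp ep p0 u2 u1]; split.
- exact: walk_image.
- by rewrite /walk_end unzip2_image.
- by case: p p0 {wp ep u2 u1}.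
- by rewrite unzip2_image.
rewrite unzip1_image map_inj_in_uniq // => x y xp yp.
by apply: f_inj; rewrite inE; apply: walk_edges wp _ _.
Qed.

(** The walk lifts edge by edge into [C]; injectivity of [f] on the edges shows that the lift uses
    all of [C]. *)
Lemma circle_walk_preimage (C : {fset E}) v q : [set` C] `<=` edges G ->
  circle_walk G' v q -> [fset f e | e in C]%fset = edge_set q ->
  exists p, circle_walk G v p /\ C = edge_set p.
Proof.
move=> CG [wq eq q0 u2 u1] eCq.
have [|p [wp defq sp]] := walk_preimage CG wq.
  by move=> e; rewrite eCq mem_edge_set.
subst q; exists p; split.
  move: eq u2 u1; rewrite /walk_end unzip2_image unzip1_image => eq u2 u1.
  by split=> //; [case: p q0 {wp eq u2 u1 sp eCq wq}|apply: map_uniq u1].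
apply/fsetP => e; rewrite mem_edge_set; apply/idP/idP => [Ce|]; last exact: sp.
have : f e \in [fset f e | e in C]%fset by apply: in_imfset.
rewrite eCq mem_edge_set unzip1_image => /mapP[e1 e1p ee1].
by rewrite (f_inj _ _ ee1) // inE; [apply: CG|apply: walk_edges wp _ e1p].
Qed.

End CircleTransfer.

(** * Cevian representations of gain graphs *)

Section CevianRepresentation.
Local Open Scope classical_set_scope.
Local Open Scope ring_scope.

Variables (F : unitRingType) (hF : GRing.field_axiom F) (N E : choiceType).

Lemma apical_joinsP A (H : set {malg F[N]}) v w :
  joins (apical_graph A) H v w <->
  v != w /\ exists2 a, a != 0 & H = link_hyp v w a.
Proof.
split=> [[p /link_apexP-/(_ hF)[vw [a a0 ->]] ->]|[vw [a a0 ->]]].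
  by split=> //; exists a; rewrite // apical_link.
exists (point_of (link_vec v w a)); last by rewrite apical_link.
by apply/link_apexP => //; split=> //; exists a.
Qed.

Section Cevian.
Variables (P : gain_graph F N E) (hP : is_gain_graph P) (simpP : gain_simple P).
Local Notation G := (gg_graph P).
Local Notation f := (edge_hyp P).
Local Notation A := (cevian P).
Let hG : is_graph G := proj1 hP.

(** The hyperplane determines the kind of edge, its nodes and its gain; [gain_simple] then leaves
    only one edge. *)
Lemma edge_hyp_inj : set_inj (edges G) f.
Proof.
move=> e e'; rewrite !inE => Ge Ge' eH.
case: (edge_cases hG Ge) => [[v hv]|[v [w vw]]];
  case: (edge_cases hG Ge') => [[v' hv']|[v' [w' vw']]]; move: eH.
- rewrite (edge_hyp_half hP Ge hv) (edge_hyp_half hP Ge' hv') => /zero_hyp_inj e_v.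
  by subst v'; apply: simpP.2 hv hv'.
- rewrite (edge_hyp_half hP Ge hv) (edge_hyp_link hF hP Ge' vw').
  by move/zero_hyp_neq_link; case; [apply: joins_neq vw'|apply: gain_neq0].
- rewrite (edge_hyp_half hP Ge' hv') (edge_hyp_link hF hP Ge vw).
  by move/esym/zero_hyp_neq_link; case; [apply: joins_neq vw|apply: gain_neq0].
have nvw := joins_neq hG Ge vw; have nvw' := joins_neq hG Ge' vw'.
have g0 := gain_neq0 hP Ge vw; have g0' := gain_neq0 hP Ge' vw'.
rewrite (edge_hyp_link hF hP Ge vw) => eH.
(* The endpoints of [e'] may come in the opposite order; gains are compared after reorienting. *)
have j' : joins G e' v w.
  move: eH; rewrite (edge_hyp_link hF hP Ge' vw').
  by case/(link_hyp_nodes nvw nvw' g0 g0') => -[<- <-] //; apply: joins_sym.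
apply: (simpP.1 e e' v w) => //; move: eH; rewrite (edge_hyp_link hF hP Ge' j').
exact: link_hyp_gain.
Qed.

Lemma edge_hyp_half_at e v : edges G e -> half_at G e v <-> f e = coord_hyp v.
Proof.
move=> Ge; rewrite coord_hypE; split=> [hv|]; first exact: edge_hyp_half.
case: (edge_cases hG Ge) => [[u hu]|[u [w uw]]].
  by rewrite (edge_hyp_half hP Ge hu) => /zero_hyp_inj <-.
rewrite (edge_hyp_link hF hP Ge uw) => /esym/zero_hyp_neq_link[].
  exact: joins_neq uw.
exact: gain_neq0.
Qed.

Lemma edge_hyp_joins e v w : edges G e ->
  joins G e v w <-> joins (apical_graph A) (f e) v w.
Proof.
move=> Ge; split=> [vw|/apical_joinsP[vw [a a0]]].
  apply/apical_joinsP; split; first exact: joins_neq vw.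
  by exists (gain P e v w); [apply: gain_neq0|apply: edge_hyp_link].
case: (edge_cases hG Ge) => [[u hu]|[x [y xy]]].
  by rewrite (edge_hyp_half hP Ge hu) => /zero_hyp_neq_link[].
rewrite (edge_hyp_link hF hP Ge xy).
have nxy := joins_neq hG Ge xy; have g0 := gain_neq0 hP Ge xy.
by case/(link_hyp_nodes nxy vw g0 a0) => -[-> ->] //; apply: joins_sym.
Qed.

Lemma bigcap_edge_hyp (S : {fset E}) :
  \bigcap_(H in [set` [fset f e | e in S]%fset]) H = solutions P S.
Proof.
apply/seteqP; split=> x hx; first by move=> e Se; apply: hx; apply/imfsetP; exists e.
by move=> _ /imfsetP[e /= Se ->]; apply: hx.
Qed.

Lemma card_edge_hyp (S : {fset E}) : [set` S] `<=` edges G ->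
  #|` [fset f e | e in S]%fset| = #|` S|.
Proof.
move=> SG; rewrite card_in_imfset /=; first reflexivity.
by move=> x y Sx Sy; apply: edge_hyp_inj; rewrite inE; apply: SG.
Qed.

Lemma cevian_set_bij : set_bij (edges G) A f.
Proof. by split=> [e Ge||//]; [exists e|exact: edge_hyp_inj]. Qed.

(** Circles correspond because the edge map is injective and fixes the nodes; [codim_circle] matches
    the two notions of balance. *)
Lemma cevian_balanced (C : {fset E}) : [set` C] `<=` edges G ->
  balanced (bias_of P) C <-> balanced (apical_biased A) [fset f e | e in C]%fset.
Proof.
move=> CG; rewrite /= bigcap_edge_hyp card_edge_hyp //.
have edgesA e : edges G e -> edges (apical_graph A) (f e) by exists e.
split=> [[v [p [cp -> g1]]]|[[v [q [cq eC]]]]].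
  split; last exact/(codim_circle hF hP cp).
  exists v, [seq (f x.1, x.2) | x <- p]; rewrite edge_set_image; split=> //.
  exact: circle_walk_image edgesA edge_hyp_inj edge_hyp_joins _ _ cp.
have [p [cp ->]] := circle_walk_preimage edge_hyp_inj edge_hyp_joins CG cq eC.
by move/(codim_circle hF hP cp) => g1; exists v, p.
Qed.

Lemma cevian_biased_iso : is_biased_iso (bias_of P) (apical_biased A) id f.
Proof.
split.
- by exists id.
- exact: cevian_set_bij.
- exact: edge_hyp_half_at.
- exact: edge_hyp_joins.
- exact: cevian_balanced.
Qed.

Lemma cevian_matroid_iso : is_matroid_iso (frame_matroid (bias_of P)) (hyp_matroid A) f.
Proof.
split=> [|S SG]; first exact: cevian_set_bij.
by rewrite -codim_frame // -bigcap_edge_hyp.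
Qed.

End Cevian.

(** * Gains recovered from a representation *)

Section Converse.
Variables (O : biased_graph N E) (A : set (set {malg F[N]})) (f : E -> set {malg F[N]}).
Hypotheses (hO : is_biased_graph O) (hf : is_biased_iso O (apical_biased A) id f).
Local Notation G := (bg_graph O).

(** The gain is read off the equation of the hyperplane; when [e] joins [v] and [w] such an equation
    exists and its coefficient is unique. *)
Definition hyp_gain (e : E) (v w : N) : F := xget 0 [set a | f e = link_hyp v w a].
Let P := GainGraph G hyp_gain.

Lemma hyp_gainP e v w : edges G e -> joins G e v w ->
  hyp_gain e v w != 0 /\ f e = link_hyp v w (hyp_gain e v w).
Proof.
have [_ _ _ jf _] := hf; move=> Ge /(jf _ _ _ Ge)/apical_joinsP[vw [a a0 fe]].
have fg : f e = link_hyp v w (hyp_gain e v w).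
  by apply: (@xgetPex _ 0 [set a | f e = link_hyp v w a]); exists a.
by split=> //; rewrite -(link_hyp_gain vw (etrans (esym fe) fg)).
Qed.

Lemma hyp_gain_graph : is_gain_graph P.
Proof.
have [hG _ _] := hO; split=> // e v w Ge vw.
have wv := joins_sym hG Ge vw.
have [g0 eg] := hyp_gainP Ge vw; have [_ eg'] := hyp_gainP Ge wv.
split=> //; apply: link_hyp_gain (joins_neq hG Ge wv) _.
by rewrite -[LHS]eg' link_hyp_sym.
Qed.

Lemma edge_hyp_hyp_gain e : edges G e -> edge_hyp P e = f e.
Proof.
have [hG _ _] := hO; have [_ _ fh _ _] := hf.
move=> Ge; case: (edge_cases hG Ge) => [[v hv]|[v [w vw]]].
  rewrite (edge_hyp_half hyp_gain_graph Ge hv) -coord_hypE.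
  by apply/esym/fh.
rewrite (edge_hyp_link hF hyp_gain_graph Ge vw).
by have [_ ->] := hyp_gainP Ge vw.
Qed.

Lemma hyp_gain_simple : gain_simple P.
Proof.
have [_ [_ finj _] fh _ _] := hf; split=> [e e' v w Ge Ge' vw vw' /= eg|e e' v Ge Ge' hv hv'].
  apply: finj; rewrite ?inE //.
  by rewrite (hyp_gainP Ge vw).2 (hyp_gainP Ge' vw').2 eg.
apply: finj; rewrite ?inE //.
have -> : f e = coord_hyp v by apply/fh.
by apply/esym/fh.
Qed.

Lemma cevian_hyp_gain : A = cevian P.
Proof.
have [_ [fA _ fsurj] _ _ _] := hf; apply/seteqP; split=> H.
  by move=> /fsurj[e Ge <-]; exists e => //; apply: edge_hyp_hyp_gain.
by move=> [e Ge <-]; rewrite edge_hyp_hyp_gain //; apply: fA.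
Qed.

(** Both biases correspond to that of [A], under edge maps that agree on the edges. As balanced sets
    are circles on either side, sets of edges suffice for the comparison. *)
Lemma bias_of_hyp_gain : bias_of P = O.
Proof.
suff ebal : balanced (bias_of P) = balanced O.
  have Oeta : O = BiasedGraph G (balanced O) by case: (O).
  by rewrite [RHS]Oeta -ebal.
have [hG circO _] := hO; have [_ _ _ _ fbal] := hf.
have key (C : {fset E}) : [set` C] `<=` edges G -> balanced (bias_of P) C <-> balanced O C.
  move=> CG; rewrite fbal // (cevian_balanced hyp_gain_graph hyp_gain_simple) //.
  rewrite -cevian_hyp_gain.
  suff -> : [fset edge_hyp P e | e in C]%fset = [fset f e | e in C]%fset by [].
  apply/fsetP => H; apply/imfsetP/imfsetP => -[e /= Ce ->]; exists e => //.
    by rewrite edge_hyp_hyp_gain //; apply: CG.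
  by rewrite edge_hyp_hyp_gain //; apply: CG.
have circG C : circle G C -> [set` C] `<=` edges G.
  by move=> [v [p [[wp _ _ _ _] ->]]] e; rewrite /= mem_edge_set; apply: walk_edges wp e.
apply/seteqP; split=> C hC.
  by apply/key => //; apply: circG; case: hC => v [p [cp -> _]]; exists v, p.
by apply/key => //; apply/circG/circO.
Qed.

End Converse.
End CevianRepresentation.

(** The apical graph has node set [N] itself, so the node map is [id]; injectivity of [coord_hyp]
    identifies each node with its coordinate hyperplane. *)
Theorem theorem2p12 (F : unitRingType) (hF : GRing.field_axiom F)
    (N E : choiceType) :
  (forall P : gain_graph F N E, is_gain_graph P -> gain_simple P ->
     injective (@coord_hyp F N) /\
     is_biased_iso (bias_of P) (apical_biased (cevian P)) id (edge_hyp P) /\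
     is_matroid_iso (frame_matroid (bias_of P)) (hyp_matroid (cevian P))
       (edge_hyp P))
  /\
  (forall (O : biased_graph N E) (A : set (set {malg F[N]})),
     is_biased_graph O ->
     (forall H, A H -> apical_hyperplane H) ->
     (exists f : E -> set {malg F[N]},
        is_biased_iso O (apical_biased A) id f) ->
     exists phi : E -> N -> N -> F,
       let P := GainGraph (bg_graph O) phi in
       is_gain_graph P /\ bias_of P = O /\ A = cevian P).
Proof.
split=> [P hP simpP|O A hO _ [f hf]].
  split; first by move=> u v; rewrite !coord_hypE; apply: zero_hyp_inj.
  by split; [apply: cevian_biased_iso|apply: cevian_matroid_iso].
exists (hyp_gain f); split; first exact: hyp_gain_graph hf.
by split; [apply: bias_of_hyp_gain hf|apply: cevian_hyp_gain hf].
Qed.
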